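(* For all integers $n\ge 0$, \[ a_{2,4}(27n)\equiv a_{2,4}(3n) \pmod 3. \]
   Context: For positive integers $r,s$, $a_{r,s}(n)$ denotes the number of multicolored partitions of $n$ in which each even part may appear in one of $r$ colors and each odd part may appear in one of $s$ colors (copies of the same part size in different colors are distinct), with $a_{r,s}(0)=1$. Equivalently, for $|q|<1$, $\sum_{n\ge0}a_{r,s}(n)q^n = f_2^{s-r}/f_1^{s}$, where $f_m=\prod_{i\ge1}(1-q^{mi})$. In particular $\sum_{n\ge0}a_{2,4}(n)q^n=f_2^2/f_1^4$. *)

(* Defs.v *)
From HB Require Import structures.
From mathcomp Require Import all_boot.

Set Implicit Arguments.
Unset Strict Implicit.
Unset Printing Implicit Defensive.

Definition ncolors (r s k : nat) : nat := if odd k then s else r.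

(* The coloured parts of size at most n; the tag i : 'I_n stands for the part
   size i.+1, so that sizes range over 1, ..., n. *)
Definition cpart (r s n : nat) : finType :=
  {i : 'I_n & 'I_(ncolors r s i.+1)}.

Definition cpart_size (r s n : nat) (p : cpart r s n) : nat := (tag p).+1.

(* A multicoloured partition of n is a finite multiset of coloured parts whose
   sizes sum to n; it is encoded by its multiplicity function. Part sizes and
   multiplicities in a partition of n never exceed n, so the bounds built into
   cpart r s n and 'I_n.+1 lose nothing. *)
Definition cpartitions (r s n : nat) : {set {ffun cpart r s n -> 'I_n.+1}} :=
  [set m : {ffun cpart r s n -> 'I_n.+1} |
    \sum_(p : cpart r s n) cpart_size p * m p == n].

Definition a (r s n : nat) : nat := #|cpartitions r s n|.

(* Main.v *)
(** Let phi = sum_(s in Z) (-1)^s q^(s^2).  Gauss' identity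
    phi = prod_k (1 - q^k) / (1 + q^k) says that the generating function
    f_2^2 / f_1^4 of a_{2,4} is 1 / phi^2.  Modulo 3 this is phi / phi^3 =
    phi(q) / phi(q^3).  A square divisible by 3 is 9 times a square, so keeping
    the exponents divisible by 3 gives
    sum_n a_{2,4}(3n) q^n = phi(q^3) / phi(q) = phi^2 modulo 3.  Finally, the
    coefficients of phi^2 at 9n and at n agree, because x^2 + y^2 = 0 modulo 3
    forces x = y = 0 modulo 3.

    Gauss' identity is the limit of a finite identity in the style of Shanks,
    proved by telescoping, whose error term for the n-th partial products is
    divisible by q^n; it is therefore exact for power series modulo q^n. *)
Require Import Defs.
From mathcomp Require Import all_boot.
From mathcomp Require Import all_algebra all_solvable all_field ring zify.

Set Implicit Arguments.
Unset Strict Implicit.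
Unset Printing Implicit Defensive.
Import GRing.Theory.
Local Open Scope ring_scope.

Reserved Notation "p = q %[modX m ]"
  (at level 70, q at next level, format "p  =  q  %[modX  m ]").
Notation "p = q %[modX m ]" := (take_poly m p = take_poly m q) : ring_scope.

Section TruncatedCongruence.
Variable R : nzRingType.
Implicit Types (p q u : {poly R}) (m n k : nat).

Lemma eq_modXP m p q :
  (forall i, (i < m)%N -> p`_i = q`_i) <-> p = q %[modX m].
Proof.
split=> [pq | /polyP pq i im].
  by apply/polyP=> i; rewrite !coef_take_poly; case: ifP => // /pq.
by have := pq i; rewrite !coef_take_poly im.
Qed.

Lemma eq_modX_leq m n p q : (m <= n)%N -> p = q %[modX n] -> p = q %[modX m].
Proof.
by move=> mn /eq_modXP pq; apply/eq_modXP => i im; rewrite pq ?(leq_trans im).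
Qed.

Lemma eq_modXM m p q p' q' :
  p = q %[modX m] -> p' = q' %[modX m] -> p * p' = q * q' %[modX m].
Proof.
move=> /eq_modXP pq /eq_modXP pq'; apply/eq_modXP => i im.
rewrite !coefM; apply: eq_bigr => j _.
by rewrite pq ?pq' ?(leq_ltn_trans _ im) ?leq_subr // -ltnS.
Qed.

Lemma eq_modXMl m u p q : p = q %[modX m] -> u * p = u * q %[modX m].
Proof. exact: eq_modXM. Qed.

Lemma eq_modXMr m u p q : p = q %[modX m] -> p * u = q * u %[modX m].
Proof. by move=> pq; exact: eq_modXM. Qed.

Lemma eq_modX_exp m k p q : p = q %[modX m] -> p ^+ k = q ^+ k %[modX m].
Proof.
by move=> pq; elim: k => [//|k IHk]; rewrite !exprS; apply: eq_modXM.
Qed.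

Lemma eq_modX_prod m (I : Type) (s : seq I) (P : pred I) (f g : I -> {poly R}) :
  (forall i, P i -> f i = g i %[modX m]) ->
  \prod_(i <- s | P i) f i = \prod_(i <- s | P i) g i %[modX m].
Proof.
by move=> fg; elim/big_ind2: _ => // p q p' q'; apply: eq_modXM.
Qed.

Lemma eq_modX_prod1 m (I : Type) (s : seq I) (P : pred I) (f : I -> {poly R}) :
  (forall i, P i -> f i = 1 %[modX m]) ->
  \prod_(i <- s | P i) f i = 1 %[modX m].
Proof. by move/eq_modX_prod->; rewrite big1. Qed.

Lemma modX_mulI m u p q :
  GRing.lreg u`_0 -> u * p = u * q %[modX m] -> p = q %[modX m].
Proof.
move=> u0_lreg /eq_modXP upq; apply/eq_modXP; elim/ltn_ind => i IHi im.
have := upq i im; rewrite !coefM !big_ord_recl /= subn0.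
suff -> : \sum_(j < i) u`_(bump 0 j) * p`_(i - bump 0 j) =
          \sum_(j < i) u`_(bump 0 j) * q`_(i - bump 0 j) by move/addIr/u0_lreg.
apply: eq_bigr => j _; have i_gt0 := leq_ltn_trans (leq0n j) (ltn_ord j).
by rewrite IHi ?(leq_ltn_trans (leq_subr _ _) im) // ltn_subrL i_gt0.
Qed.

Lemma modX_XnM m k p : (m <= k)%N -> 'X^k * p = 0 %[modX m].
Proof.
move=> mk; apply/eq_modXP => i im.
by rewrite coefXnM coef0 (leq_trans im mk).
Qed.

Lemma modX_1BXn m k : (m <= k)%N -> 1 - 'X^k = (1 : {poly R}) %[modX m].
Proof.
by move=> mk; rewrite -mulrN1 take_polyD modX_XnM // take_poly0r addr0.
Qed.

Lemma coef0_1BXn k : (0 < k)%N -> (1 - 'X^k : {poly R})`_0 = 1.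
Proof.
by move=> k_gt0; rewrite coefB coef1 coefXn (ltn_eqF k_gt0) subr0.
Qed.

Lemma modX_prod_nat m n i0 (P : pred nat) (f : nat -> {poly R}) :
  (i0 <= m <= n)%N -> (forall k, (m <= k)%N -> f k = 1 %[modX m]) ->
  \prod_(i0 <= k < n | P k) f k = \prod_(i0 <= k < m | P k) f k %[modX m].
Proof.
move=> /andP[im mn] f_eq1; rewrite (big_cat_nat im mn) /=.
rewrite -[X in _ = take_poly m X]mulr1.
apply: eq_modXMl; rewrite big_nat_cond.
by apply: eq_modX_prod1 => k /andP[/andP[/f_eq1]].
Qed.

End TruncatedCongruence.

Section Multisection.
Variables (R : comNzRingType) (d : nat).
Hypothesis d_gt0 : (0 < d)%N.
Implicit Types p q : {poly R}.

Definition section_poly p : {poly R} := \poly_(i < size p) p`_(d * i).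

Lemma coef_section_poly p i : (section_poly p)`_i = p`_(d * i).
Proof.
rewrite coef_poly; case: ltnP => // size_p_i.
by rewrite nth_default // (leq_trans size_p_i) // leq_pmull.
Qed.

Lemma section_polyD p q :
  section_poly (p + q) = section_poly p + section_poly q.
Proof. by apply/polyP=> i; rewrite !(coefD, coef_section_poly). Qed.

Lemma section_polyM_comp p q :
  section_poly (p * (q \Po 'X^d)) = section_poly p * q.
Proof.
elim/poly_ind: q => [|q c IHq].
  by apply/polyP=> i; rewrite comp_poly0 !mulr0 coef_section_poly !coef0.
rewrite comp_polyD comp_polyM comp_polyX comp_polyC !mulrDr section_polyD.
rewrite !mulrA -IHq.
congr (_ + _); apply/polyP=> i.
  rewrite coef_section_poly coefMXn coefMX coef_section_poly.
  case: i => [|i]; first by rewrite muln0 d_gt0.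
  by rewrite mulnS ltnNge leq_addr addKn.
by rewrite coef_section_poly !coefMC coef_section_poly.
Qed.

Lemma section_polyXn k :
  section_poly 'X^k = if (d %| k)%N then 'X^(k %/ d) else 0.
Proof.
apply/polyP=> i; rewrite coef_section_poly coefXn.
case: (boolP (d %| k)%N) => [/dvdnP[j ->]|d_ndvd_k].
  by rewrite mulnK // coefXn mulnC eqn_pmul2r.
by rewrite coef0; case: eqP d_ndvd_k => // <-; rewrite dvdn_mulr.
Qed.

Lemma section_poly_comp q : section_poly (q \Po 'X^d) = q.
Proof.
rewrite -[_ \Po _]mul1r section_polyM_comp (section_polyXn 0).
by rewrite dvdn0 div0n mul1r.
Qed.

Lemma section_polyXnM_comp k q :
  ~~ (d %| k)%N -> section_poly ('X^k * (q \Po 'X^d)) = 0.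
Proof.
move/negPf=> d_ndvd_k.
by rewrite section_polyM_comp section_polyXn d_ndvd_k mul0r.
Qed.

Lemma section_poly_modX m p q :
  p = q %[modX d * m] -> section_poly p = section_poly q %[modX m].
Proof.
move=> /eq_modXP pq; apply/eq_modXP=> i im.
by rewrite !coef_section_poly pq // ltn_pmul2l.
Qed.

End Multisection.

Lemma exp_card_poly (F : finFieldType) (p : {poly F}) :
  p ^+ #|F| = p \Po 'X^#|F|.
Proof.
have [ch _ pchar_F] := finPcharP F.
have pchar_nat : [pchar {poly F}].-nat #|F|.
  have := abelem_pgroup (fin_ring_pchar_abelem pchar_F).
  rewrite /pgroup cardsT -(eq_pnat _ (pcharf_eq pchar_F)).
  by rewrite (eq_pnat _ (pchar_poly F)).
elim/poly_ind: p => [|p c IHp].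
  have card_gt0 : (0 < #|F|)%N by apply/card_gt0P; exists 0.
  by rewrite comp_poly0 expr0n (gtn_eqF card_gt0).
rewrite exprDn_pchar // exprMn IHp comp_polyD comp_polyM comp_polyX comp_polyC.
by rewrite -rmorphXn /= expf_card.
Qed.

Section QSeries.
Variables (R : comNzRingType) (q : R).

Definition qprod1B m n : R := \prod_(m <= k < n) (1 - q ^+ k).

Definition qprod1B_odd n : R := \prod_(1 <= k < n | odd k) (1 - q ^+ k).

Definition qprod1D n : R := \prod_(1 <= k < n) (1 + q ^+ k).

(* For n > 0, the sum of (-1)^s q^(s^2) over the integers s with |s| < n. *)
Definition theta_sum n : R :=
  1 + 2 * \sum_(1 <= s < n) (-1) ^+ s * q ^+ (s ^ 2).

(* The terms of theta_sum with s = 3t + 1 and s = 3t + 2 are q times the terms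
   of this sum, evaluated at q^3. *)
Definition theta_off3_sum n : R :=
  2 * \sum_(0 <= t < n)
        (-1) ^+ t * (q ^+ (3 * t ^ 2 + 4 * t + 1) - q ^+ (3 * t ^ 2 + 2 * t)).

Definition shanks_term n s : R :=
  (-1) ^+ s * q ^+ (s * n) * qprod1B s.+1 n * qprod1D s.

Definition shanks_primitive n s : R :=
  (-1) ^+ s * q ^+ (s * n) * qprod1B s n * qprod1D s.

Definition shanks_rem n : R := 2 * \sum_(1 <= s < n) shanks_term n s.

Lemma qprod1B_geq m n : (n <= m)%N -> qprod1B m n = 1.
Proof. exact: big_geq. Qed.

Lemma qprod1B_recl m n : (m < n)%N ->
  qprod1B m n = (1 - q ^+ m) * qprod1B m.+1 n.
Proof. exact: big_ltn. Qed.

Lemma qprod1B_recr m n : (m <= n)%N ->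
  qprod1B m n.+1 = qprod1B m n * (1 - q ^+ n).
Proof. exact: big_nat_recr. Qed.

Lemma qprod1D1 : qprod1D 1 = 1.
Proof. exact: big_geq. Qed.

Lemma qprod1D_recr n : (0 < n)%N -> qprod1D n.+1 = qprod1D n * (1 + q ^+ n).
Proof. exact: big_nat_recr. Qed.

Lemma theta_sum_recr n : (0 < n)%N ->
  theta_sum n.+1 = theta_sum n + 2 * ((-1) ^+ n * q ^+ (n ^ 2)).
Proof. by move=> n_gt0; rewrite /theta_sum big_nat_recr //= mulrDr addrA. Qed.

Lemma theta_off3_sum_recr n :
  theta_off3_sum n.+1 = theta_off3_sum n
    + 2 * ((-1) ^+ n
           * (q ^+ (3 * n ^ 2 + 4 * n + 1) - q ^+ (3 * n ^ 2 + 2 * n))).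
Proof. by rewrite /theta_off3_sum big_nat_recr //= mulrDr. Qed.

Lemma shanks_term_telescope n s : (0 < s < n)%N ->
  shanks_term n.+1 s - (1 + q ^+ n) * shanks_term n s =
  shanks_primitive n s.+1 - shanks_primitive n s.
Proof.
move=> /andP[s_gt0 sn]; rewrite /shanks_term /shanks_primitive.
rewrite qprod1B_recr // (qprod1B_recl sn) qprod1D_recr //.
rewrite mulnS mulSn !exprD (exprS (-1)).
by ring.
Qed.

Lemma shanks_rem_recr n : (0 < n)%N ->
  shanks_rem n.+1 = (1 + q ^+ n) * shanks_rem n
    + 2 * (q ^+ n * qprod1B 1 n + (-1) ^+ n * q ^+ (n ^ 2) * qprod1D n.+1).
Proof.
move=> n_gt0; apply/eqP; rewrite addrC -subr_eq; apply/eqP.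
rewrite /shanks_rem mulrCA -mulrBr big_nat_recr //= mulr_sumr addrAC -sumrB.
rewrite (telescope_sumr_eq (shanks_primitive n) _ n_gt0
           (@shanks_term_telescope n)).
rewrite /shanks_term /shanks_primitive !(qprod1B_geq (leqnn _)) qprod1D1.
rewrite qprod1D_recr // -mulnn mulnS mul1n !exprD expr1.
by ring.
Qed.

Lemma gauss_identity_finite n : (0 < n)%N ->
  theta_sum n * qprod1D n = qprod1B 1 n + shanks_rem n.
Proof.
elim: n => // n IHn _; have [->|n_gt0] := posnP n.
  rewrite /theta_sum /shanks_rem qprod1D1 qprod1B_geq // !big_geq //.
  by rewrite !mulr0 mulr1.
rewrite theta_sum_recr // shanks_rem_recr // qprod1B_recr // mulrDl.
by rewrite {1}qprod1D_recr // mulrA IHn //; ring.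
Qed.

Lemma qprod1B_double n : (0 < n)%N ->
  qprod1B 1 n.*2 = qprod1B_odd n.*2 * (qprod1B 1 n * qprod1D n).
Proof.
elim: n => // n IHn _; have [->|n_gt0] := posnP n.
  rewrite (qprod1B_geq (leqnn 1)) qprod1D1 !mulr1.
  by rewrite /qprod1B /qprod1B_odd [RHS]big_mkcond !big_nat1.
have n2_gt0 : (0 < n.*2)%N by rewrite double_gt0.
have qprod1B_odd_double :
    qprod1B_odd n.*2.+2 = qprod1B_odd n.*2 * (1 - q ^+ n.*2.+1).
  rewrite /qprod1B_odd [LHS]big_mkcond [in RHS]big_mkcond /= 2?big_nat_recr //=.
  by rewrite odd_double mulr1.
rewrite doubleS qprod1B_odd_double !qprod1B_recr ?IHn // qprod1D_recr //.
by rewrite -[in q ^+ n.*2]addnn exprD; ring.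
Qed.

End QSeries.

Lemma theta_sum_dissection3 (R : comNzRingType) (q : R) n :
  theta_sum q (3 * n) = theta_sum (q ^+ 9) n + q * theta_off3_sum (q ^+ 3) n.
Proof.
elim: n => [|n IHn].
  by rewrite muln0 /theta_sum /theta_off3_sum !big_geq // !mulr0 !addr0.
rewrite theta_off3_sum_recr (_ : 3 * n.+1 = (3 * n).+3)%N; last by lia.
have [->|n_gt0] := posnP n.
  rewrite muln0 2?(@theta_sum_recr _ _ _.+1) //.
  rewrite /theta_sum /theta_off3_sum !big_geq //.
  by rewrite -!exprM; ring.
have sign_mul3 : (-1) ^+ (3 * n) = (-1) ^+ n :> R.
  by rewrite -signr_odd oddM signr_odd.
rewrite !theta_sum_recr ?muln_gt0 // IHn -!exprM !(exprS (-1)) sign_mul3.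
have -> : ((3 * n) ^ 2 = 9 * n ^ 2)%N by lia.
have -> : ((3 * n).+1 ^ 2 = (3 * (3 * n ^ 2 + 2 * n)).+1)%N by lia.
have -> : ((3 * n).+2 ^ 2 = (3 * (3 * n ^ 2 + 4 * n + 1)).+1)%N by lia.
rewrite !(exprS q).
by ring.
Qed.

Section RingMorphism.
Variables (R S : comNzRingType) (f : {rmorphism R -> S}).

Lemma rmorph_theta_sum q n : f (theta_sum q n) = theta_sum (f q) n.
Proof.
rewrite /theta_sum rmorphD rmorphM rmorph1 rmorph_nat rmorph_sum.
by under eq_bigr do rewrite rmorphM rmorph_sign rmorphXn.
Qed.

Lemma rmorph_theta_off3_sum q n :
  f (theta_off3_sum q n) = theta_off3_sum (f q) n.
Proof.
rewrite /theta_off3_sum rmorphM rmorph_nat rmorph_sum.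
by under eq_bigr do rewrite rmorphM rmorph_sign rmorphB !rmorphXn.
Qed.

End RingMorphism.

Section QSeriesModXn.
Variable R : comNzRingType.

Lemma coef0_qprod1B n : (qprod1B ('X : {poly R}) 1 n)`_0 = 1.
Proof.
by rewrite coef0_prod big_nat big1 // => k /andP[k_gt0 _]; rewrite coef0_1BXn.
Qed.

Lemma coef0_qprod1D n : (qprod1D ('X : {poly R}) n)`_0 = 1.
Proof.
rewrite coef0_prod big_nat big1 // => k /andP[k_gt0 _].
by rewrite coefD coef1 coefXn (ltn_eqF k_gt0) addr0.
Qed.

Lemma theta_sum_modX m n : (m <= n)%N ->
  theta_sum 'X n = theta_sum ('X : {poly R}) m %[modX m].
Proof.
case: m => [|m] mn; first by rewrite !take_poly0l.
rewrite /theta_sum (big_cat_nat (ltn0Sn m) mn) /= mulrDr addrA [LHS]take_polyD.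
rewrite [X in _ + X](_ : _ = 0) ?addr0 //.
rewrite mulr_sumr take_poly_sum big_nat big1 // => s /andP[ms _].
rewrite mulrA mulrC modX_XnM ?take_poly0r //.
by rewrite (leq_trans ms) // -mulnn leq_pmulr // (leq_ltn_trans _ ms).
Qed.

Lemma coef0_theta_sum n : (theta_sum ('X : {poly R}) n.+1)`_0 = 1.
Proof.
have /eq_modXP -> // := theta_sum_modX (ltn0Sn n).
by rewrite /theta_sum big_geq // mulr0 addr0 coef1.
Qed.

Lemma shanks_rem_modX n : shanks_rem ('X : {poly R}) n = 0 %[modX n].
Proof.
rewrite /shanks_rem mulr_sumr take_poly_sum take_poly0r big_nat big1 //.
move=> s /andP[s_gt0 _]; rewrite /shanks_term -!mulrA !(mulrCA _ 'X^_).
by rewrite modX_XnM ?take_poly0r // leq_pmull.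
Qed.

Lemma gauss_identity_modX n :
  theta_sum 'X n * qprod1D 'X n = qprod1B ('X : {poly R}) 1 n %[modX n].
Proof.
case: n => [|n]; first by rewrite !take_poly0l.
rewrite gauss_identity_finite // take_polyD shanks_rem_modX.
by rewrite take_poly0r addr0.
Qed.

Lemma euler_odd_distinct_modX n :
  qprod1B_odd 'X n * qprod1D 'X n = (1 : {poly R}) %[modX n].
Proof.
case: n => [|n]; first by rewrite !take_poly0l.
apply: (@modX_mulI _ _ (qprod1B 'X 1 n.+1)).
  by rewrite coef0_qprod1B; exact: lreg1.
have n_leq_double : (0 < n.+1 <= n.+1.*2)%N by rewrite -addnn leq_addr.
rewrite mulr1 mulrCA -[RHS](modX_prod_nat _ n_leq_double (@modX_1BXn R n.+1)).
rewrite -/(qprod1B _ _ _) qprod1B_double //; apply/eq_modXMr/esym.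
exact: modX_prod_nat n_leq_double (@modX_1BXn R n.+1).
Qed.

End QSeriesModXn.

Section ColouredPartitions.
Variables (R : comNzRingType) (r s : nat).

Definition cpart_gf n : {poly R} := \poly_(i < n) (a r s i)%:R.

Definition cpart_den n : {poly R} :=
  \prod_(1 <= k < n) (1 - 'X^k) ^+ ncolors r s k.

Definition cpart_geom n : {poly R} :=
  \prod_(1 <= k < n) (\sum_(j < n) 'X^(k * j)) ^+ ncolors r s k.

Lemma coef_cpart_geom n : (cpart_geom n.+1)`_n = (a r s n)%:R.
Proof.
have -> : cpart_geom n.+1 =
    \prod_(p : cpart r s n) \sum_(j < n.+1) 'X^(cpart_size p * j).
  rewrite -(sig_big_dep xpredT (fun=> xpredT)
    (fun (i : 'I_n) (c : 'I_(ncolors r s i.+1)) =>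
       \sum_(j < n.+1) 'X^(i.+1 * j) : {poly R})) /=.
  rewrite /cpart_geom big_add1 big_mkord.
  by apply: eq_bigr => i _; rewrite prodr_const card_ord.
rewrite bigA_distr_bigA coef_sum /a -sum1_card natr_sum [RHS]big_mkcond /=.
apply: eq_bigr => m _; rewrite -expr_sum coefXn inE eq_sym.
by case: eqP.
Qed.

Lemma cpart_den_geom n : cpart_den n * cpart_geom n = 1 %[modX n].
Proof.
rewrite -big_split big_nat_cond.
apply: eq_modX_prod1 => k /andP[/andP[k_gt0 _] _] /=.
rewrite -exprMn -[in RHS](expr1n _ (ncolors r s k)); apply: eq_modX_exp.
under eq_bigr do rewrite exprM.
rewrite -opprB mulNr -subrX1 opprB -exprM.
by apply: modX_1BXn; rewrite leq_pmull.
Qed.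

Lemma cpart_den_modX m n : (m <= n)%N -> cpart_den n = cpart_den m %[modX m].
Proof.
case: m => [|m] mn; first by rewrite !take_poly0l.
apply: modX_prod_nat => // k mk.
by rewrite -[in RHS](expr1n _ (ncolors r s k)); apply/eq_modX_exp/modX_1BXn.
Qed.

Lemma coef0_cpart_den n : (cpart_den n)`_0 = 1.
Proof.
rewrite coef0_prod big_nat big1 // => k /andP[k_gt0 _].
by rewrite -horner_coef0 horner_exp horner_coef0 coef0_1BXn // expr1n.
Qed.

Lemma cpart_geom_modX m n : (m <= n)%N -> cpart_geom n = cpart_geom m %[modX m].
Proof.
move=> mn; apply: (@modX_mulI _ _ (cpart_den m)).
  by rewrite coef0_cpart_den; exact: lreg1.
rewrite cpart_den_geom -(eq_modX_leq mn (cpart_den_geom n)).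
exact/eq_modXMr/esym/cpart_den_modX.
Qed.

Lemma cpart_den_gf n : cpart_den n * cpart_gf n = 1 %[modX n].
Proof.
rewrite -(cpart_den_geom n); apply/eq_modXMl/eq_modXP => i lt_in.
rewrite coef_poly lt_in -coef_cpart_geom.
by have /eq_modXP -> := cpart_geom_modX lt_in.
Qed.

End ColouredPartitions.

Lemma cpart_den_addn (R : comNzRingType) r s n :
  cpart_den R r (r + s) n = qprod1B 'X 1 n ^+ r * qprod1B_odd 'X n ^+ s.
Proof.
rewrite /qprod1B_odd big_mkcond -!prodrXl -big_split; apply: eq_bigr => k _ /=.
by rewrite /ncolors; case: odd; rewrite ?exprD // expr1n mulr1.
Qed.

Lemma cpart_den24_theta_sum (R : comNzRingType) n :
  cpart_den R 2 4 n = theta_sum 'X n ^+ 2 %[modX n].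
Proof.
apply: (@modX_mulI _ _ (qprod1D 'X n ^+ 2)).
  by rewrite coef0M coef0_qprod1D mulr1; exact: lreg1.
rewrite (cpart_den_addn R 2 2) mulrCA -!exprMn [qprod1D _ _ * _]mulrC.
rewrite [_ * theta_sum _ _]mulrC; apply: eq_modX_exp.
rewrite gauss_identity_modX -[X in _ = take_poly _ X]mulr1.
exact/eq_modXMl/euler_odd_distinct_modX.
Qed.

Lemma theta_sum_sqr_cpart_gf24 (R : comNzRingType) n :
  theta_sum 'X n ^+ 2 * cpart_gf R 2 4 n = 1 %[modX n].
Proof.
by rewrite -(cpart_den_gf R 2 4) -(eq_modXMr _ (cpart_den24_theta_sum R n)).
Qed.

Section ThetaSections.
Variable R : comNzRingType.

Lemma theta_sum_polyX_dissection3 n :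
  theta_sum ('X : {poly R}) (3 * n) =
  ((theta_sum 'X n \Po 'X^3) \Po 'X^3) + 'X^1 * (theta_off3_sum 'X n \Po 'X^3).
Proof.
rewrite theta_sum_dissection3 !(rmorph_theta_sum, rmorph_theta_off3_sum).
by rewrite /= !comp_polyX comp_Xn_poly -exprM.
Qed.

Lemma section3_theta_sum n :
  section_poly 3 (theta_sum ('X : {poly R}) (3 * n)) = theta_sum 'X n \Po 'X^3.
Proof.
rewrite theta_sum_polyX_dissection3 section_polyD //.
by rewrite section_poly_comp // section_polyXnM_comp // addr0.
Qed.

Lemma section3_theta_sum_sqr n :
  section_poly 3 (theta_sum ('X : {poly R}) (3 * n) ^+ 2) =
  theta_sum 'X n ^+ 2 \Po 'X^3.
Proof.
rewrite theta_sum_polyX_dissection3.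
set T := theta_sum _ _; set B := theta_off3_sum _ _.
have -> : (((T \Po 'X^3) \Po 'X^3) + 'X^1 * (B \Po 'X^3)) ^+ 2 =
    ((T ^+ 2 \Po 'X^3) \Po 'X^3) + 'X^1 * ((2 * (T \Po 'X^3) * B) \Po 'X^3)
    + 'X^2 * ((B ^+ 2) \Po 'X^3).
  by rewrite !(rmorphM, rmorphXn, rmorph_nat) /=; ring.
rewrite !section_polyD // section_poly_comp //.
by rewrite !section_polyXnM_comp // !addr0.
Qed.

Lemma coef_theta_sum_sqr_stable n m : (n < m)%N ->
  (theta_sum ('X : {poly R}) m ^+ 2)`_n = (theta_sum 'X n.+1 ^+ 2)`_n.
Proof.
by move=> nm; have /eq_modXP -> := eq_modX_exp 2 (theta_sum_modX R nm).
Qed.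

Lemma coef_theta_sum_sqr_mul9 n :
  (theta_sum ('X : {poly R}) (9 * n).+1 ^+ 2)`_(9 * n) =
  (theta_sum 'X n.+1 ^+ 2)`_n.
Proof.
rewrite -(@coef_theta_sum_sqr_stable _ (3 * (3 * n.+1))); last by lia.
rewrite -[9%N]/(3 * 3)%N -mulnA -coef_section_poly // section3_theta_sum_sqr.
rewrite coef_comp_poly_Xn // dvdn_mulr // mulKn //.
by apply: coef_theta_sum_sqr_stable; lia.
Qed.

End ThetaSections.

Lemma section3_cpart_gf24 n :
  section_poly 3 (cpart_gf 'F_3 2 4 (3 * n)) = theta_sum 'X n ^+ 2 %[modX n].
Proof.
set A := cpart_gf _ _ _ _; set T := theta_sum 'X n.
case: n => [|n] in A T *; first by rewrite !take_poly0l.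
apply: (@modX_mulI _ _ T); first by rewrite coef0_theta_sum; exact: lreg1.
have frobenius (p : {poly 'F_3}) : p ^+ 3 = p \Po 'X^3.
  by have := exp_card_poly p; rewrite card_Fp.
have theta_gf : theta_sum 'X (3 * n.+1) ^+ 3 * A =
    theta_sum 'X (3 * n.+1) %[modX 3 * n.+1].
  rewrite exprS -mulrA -[X in _ = take_poly _ X]mulr1.
  exact/eq_modXMl/theta_sum_sqr_cpart_gf24.
rewrite -exprS frobenius -section3_theta_sum -(section_poly_modX _ theta_gf) //.
rewrite frobenius mulrC [in RHS]mulrC section_polyM_comp //.
by apply/eq_modXMl/esym/theta_sum_modX; rewrite leq_pmull.
Qed.

Lemma natr_a24_mul3 n :
  (a 2 4 (3 * n))%:R = (theta_sum 'X n.+1 ^+ 2 : {poly 'F_3})`_n.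
Proof.
have /eq_modXP/(_ _ (ltnSn n)) <- := section3_cpart_gf24 n.+1.
by rewrite coef_section_poly // coef_poly ltn_pmul2l // ltnSn.
Qed.

Theorem theorem1p8 (n : nat) : a 2 4 (27 * n) = a 2 4 (3 * n) %[mod 3].
Proof.
suff eq_F3 : (a 2 4 (27 * n))%:R = (a 2 4 (3 * n))%:R :> 'F_3.
  by have := congr1 val eq_F3; rewrite /= !val_Fp_nat.
by rewrite -[27%N]/(3 * 9)%N -mulnA !natr_a24_mul3 coef_theta_sum_sqr_mul9.
Qed.
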